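(* Let $Y$ be a closed subspace of finite co-dimension in the real Banach space $c_0$. Then $Y$ has property-$(HB)$ in $c_0$ if and only if $Y=F\bigoplus_{\ell_\infty}Z$, where for some $k\in\mathbb{N}$, $F$ is a subspace of $\ell_\infty(k)$, $Z=\{z\in c_0: z(j)=0\text{ for all }j\le k\}$, and $F$ has property-$(HB)$ in $\ell_\infty(k)$.
   Context: $\ell_\infty(k)$ is $\mathbb{R}^k$ with the maximum norm, identified with the subspace of $c_0$ of sequences supported on the first $k$ coordinates, so that $c_0=\ell_\infty(k)\bigoplus_{\ell_\infty}Z$; $\bigoplus_{\ell_\infty}$ denotes the direct sum with the maximum norm. For a closed subspace $Y$ of a Banach space $X$, $Y^\perp=\{x^*\in X^*: x^*(y)=0\ \forall y\in Y\}$. $Y$ has property-$(HB)$ in $X$ if there is a closed subspace $G$ of $X^*$ with $X^*=G\oplus Y^\perp$ such that for each $x^*\in X^*$, $\|x^*\|>\|y^\#\|$ and $\|x^*\|\ge\|y^\perp\|$ whenever $x^*=y^\#+y^\perp$ with $y^\#\in G$ and $0\ne y^\perp\in Y^\perp$. *)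

(* Defs.v *)
From HB Require Import structures.
From mathcomp Require Import all_boot all_order all_algebra.
From mathcomp Require Import all_classical all_reals all_analysis.

Set Implicit Arguments.
Unset Strict Implicit.
Unset Printing Implicit Defensive.

Import Order.TTheory GRing.Theory Num.Theory.
Import numFieldNormedType.Exports.

Local Open Scope classical_set_scope.
Local Open Scope ring_scope.

Section Subspaces.
Context {R : realType} {X : normedModType R}.
Implicit Types U V W : set X.

Definition linear_subspace U := submod_closed [in U].

Definition closed_linear_subspace U := linear_subspace U /\ closed U.

(* The classes of the v i span the quotient X / U. *)
Definition finite_codim U := exists (n : nat) (v : 'I_n -> X),
  forall x, exists a : 'I_n -> R, U (x - \sum_(i < n) a i *: v i).

Definition is_direct_sum U V W :=
  U = [set v + w | v in V & w in W] /\ V `&` W = [set 0].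

Definition is_linf_direct_sum U V W := is_direct_sum U V W /\
  forall v w, V v -> W w -> `|v + w| = Num.max `|v| `|w|.

End Subspaces.

Section Dual.
Context {R : realType} (X : normedModType R).

Definition dual_pred : {pred X -> R} :=
  [in [set f : X -> R | linear f /\ continuous f]].

Record dual_space := DualSpace { dual_fun :> X -> R ; dual_funP : dual_fun \in dual_pred }.

HB.instance Definition _ := [isSub for dual_fun].
HB.instance Definition _ := [Choice of dual_space by <:].

Fact dual_submod_closed : submod_closed dual_pred.
Proof.
split.
  rewrite inE/=; split; last by move=> x; exact: cvg_cst.
  by move=> a x y /=; rewrite scaler0 addr0.
move=> a f g /[!inE]/= -[lf cf] [lg cg]; split.
  move=> b x y; rewrite /= !fctE lf lg !scalerDr !scalerA (mulrC a b).
  by rewrite addrACA.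
by move=> x; apply: cvgD; [apply: cvgZl_tmp; exact: cf|exact: cg].
Qed.

HB.instance Definition _ :=
  GRing.isSubmodClosed.Build R (X -> R) dual_pred dual_submod_closed.
HB.instance Definition _ := [SubChoice_isSubLmodule of dual_space by <:].

Implicit Types f g : dual_space.

Definition dual_norm f : R := sup [set `|f x| | x in [set x | `|x| <= 1]].

Fact dual_linear f : linear f.
Proof. by have := dual_funP f; rewrite inE => -[]. Qed.

Fact dual_continuous f : continuous f.
Proof. by have := dual_funP f; rewrite inE => -[]. Qed.

Fact dual_has_sup f : has_sup [set `|f x| | x in [set x | `|x| <= 1]].
Proof.
pose h : {linear X -> R} :=
  HB.pack (dual_fun f) (GRing.isLinear.Build _ _ _ _ _ (dual_linear f)).
split; first by exists `|f 0|, 0 => //=; rewrite normr0.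
have /linear_bounded_continuous/bounded_funP/(_ 1)[M hM] : continuous h.
  exact: dual_continuous.
by exists M => _ [x /= x1 <-]; exact: hM.
Qed.

Fact dual_norm_ub f x : `|x| <= 1 -> `|f x| <= dual_norm f.
Proof.
by move=> x1; apply: ub_le_sup; [case: (dual_has_sup f)|exists x].
Qed.

Fact dual_norm_le f M :
  (forall x, `|x| <= 1 -> `|f x| <= M) -> dual_norm f <= M.
Proof.
move=> hM; apply: ge_sup; first by case: (dual_has_sup f).
by move=> _ [x /= x1 <-]; exact: hM.
Qed.

Fact ler_dual_normD f g : dual_norm (f + g) <= dual_norm f + dual_norm g.
Proof.
apply: dual_norm_le => x x1; apply: (le_trans (ler_normD _ _)).
by apply: lerD; exact: dual_norm_ub.
Qed.

Fact dual_norm_ge0 f : 0 <= dual_norm f.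
Proof. by rewrite (le_trans (normr_ge0 (f 0)))// dual_norm_ub// normr0. Qed.

Fact dual_normZ (a : R) f : dual_norm (a *: f) = `|a| * dual_norm f.
Proof.
have le b g : dual_norm (b *: g) <= `|b| * dual_norm g.
  apply: dual_norm_le => x x1.
  by rewrite (_ : (b *: g) x = b * g x)// normrM ler_wpM2l// dual_norm_ub.
apply/eqP; rewrite eq_le le/=; have [->|a0] := eqVneq a 0.
  by rewrite normr0 mul0r dual_norm_ge0.
rewrite -ler_pdivlMl ?normr_gt0// -normfV.
by have := le a^-1 (a *: f); rewrite scalerA mulVf// scale1r.
Qed.

Fact dual_norm_eq0 f : dual_norm f = 0 -> f = 0.
Proof.
move=> f0; apply/val_inj/funext => x /=; apply/eqP.
have lf := dual_linear f.
have Zf a y : f (a *: y) = a * f y.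
  pose h : {linear X -> R} :=
    HB.pack (dual_fun f) (GRing.isLinear.Build _ _ _ _ _ lf).
  exact: (linearZ_LR h a y).
have [->|x0] := eqVneq x 0; first by rewrite -(scale0r 0) Zf mul0r.
rewrite -normr_le0.
have : `|f (`|x|^-1 *: x)| <= 0.
  rewrite -f0; apply: dual_norm_ub.
  by rewrite normrZ normfV normr_id mulVf// normr_eq0.
have x1 : 0 < `|(`|x|^-1)| by rewrite normr_gt0 invr_eq0 normr_eq0.
by rewrite Zf normrM pmulr_rle0.
Qed.

HB.instance Definition _ := Lmodule_isNormed.Build R dual_space
  ler_dual_normD dual_normZ dual_norm_eq0.

End Dual.

Section PropertyHB.
Context {R : realType} {X : normedModType R}.

Definition annihilator (Y : set X) : set (dual_space X) :=
  [set f | forall y, Y y -> f y = 0].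

Definition property_HB (Y : set X) := exists G : set (dual_space X),
  [/\ closed_linear_subspace G,
      is_direct_sum [set: dual_space X] G (annihilator Y) &
      forall f g h : dual_space X, f = g + h -> G g -> annihilator Y h -> h != 0 ->
        `|g| < `|f| /\ `|h| <= `|f|].

End PropertyHB.

Section C0.
Context (R : realType).

Definition c0_pred : {pred nat -> R} :=
  [in [set u : nat -> R | u @ \oo --> (0 : R)]].

Record c0 := C0 { c0_seq :> nat -> R ; c0_seqP : c0_seq \in c0_pred }.

HB.instance Definition _ := [isSub for c0_seq].
HB.instance Definition _ := [Choice of c0 by <:].

Fact c0_submod_closed : submod_closed c0_pred.
Proof.
split; first by rewrite inE/=; exact: cvg_cst.
move=> a u v /[!inE]/= cu cv.
rewrite (_ : (0 : R) = a * 0 + 0); last by rewrite mulr0 addr0.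
by apply: cvgD => //; exact: cvgMl_tmp.
Qed.

HB.instance Definition _ :=
  GRing.isSubmodClosed.Build R (nat -> R) c0_pred c0_submod_closed.
HB.instance Definition _ := [SubChoice_isSubLmodule of c0 by <:].

Implicit Types u v : c0.

Definition c0_norm u : R := sup [set `|u n| | n in [set: nat]].

Fact c0_has_sup u : has_sup [set `|u n| | n in [set: nat]].
Proof.
split; first by exists `|u 0|, 0%N.
have cu : u @ \oo --> (0 : R) by have := c0_seqP u; rewrite inE.
have [M [_ hM]] : bounded_fun u by apply: cvg_seq_bounded; apply/cvg_ex; exists 0.
by exists (M + 1) => _ [n _ <-]; apply: hM; rewrite ?ltrDl.
Qed.

Fact c0_norm_ub u n : `|u n| <= c0_norm u.
Proof. by apply: ub_le_sup; [case: (c0_has_sup u)|exists n]. Qed.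

Fact c0_norm_le u M : (forall n, `|u n| <= M) -> c0_norm u <= M.
Proof.
move=> hM; apply: ge_sup; first by case: (c0_has_sup u).
by move=> _ [n _ <-]; exact: hM.
Qed.

Fact ler_c0_normD u v : c0_norm (u + v) <= c0_norm u + c0_norm v.
Proof.
apply: c0_norm_le => n; apply: (le_trans (ler_normD _ _)).
by apply: lerD; exact: c0_norm_ub.
Qed.

Fact c0_normZ (a : R) u : c0_norm (a *: u) = `|a| * c0_norm u.
Proof.
have le b v : c0_norm (b *: v) <= `|b| * c0_norm v.
  apply: c0_norm_le => n.
  by rewrite (_ : (b *: v) n = b * v n)// normrM ler_wpM2l// c0_norm_ub.
apply/eqP; rewrite eq_le le/=; have [->|a0] := eqVneq a 0.
  by rewrite normr0 mul0r (le_trans _ (c0_norm_ub _ 0%N)).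
rewrite -ler_pdivlMl ?normr_gt0// -normfV.
by have := le a^-1 (a *: u); rewrite scalerA mulVf// scale1r.
Qed.

Fact c0_norm_eq0 u : c0_norm u = 0 -> u = 0.
Proof.
move=> u0; apply/val_inj/funext => n /=; apply/eqP.
by rewrite -normr_le0 -u0 c0_norm_ub.
Qed.

HB.instance Definition _ := Lmodule_isNormed.Build R c0
  ler_c0_normD c0_normZ c0_norm_eq0.

(* The library norm on ['rV[R]_k] is the maximum norm, so this type is
   l_infty(k). *)
Definition linf_seq (k : nat) (x : 'rV[R]_k) : nat -> R :=
  fun n => if insub n is Some i then x 0 i else 0.

Fact linf_seqP k (x : 'rV[R]_k) : linf_seq x \in c0_pred.
Proof.
rewrite inE/=; apply: cvg_near_cst; exists k => // n /= kn.
by rewrite /linf_seq insubF// ltnNge kn.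
Qed.

Definition linf_c0 (k : nat) (x : 'rV[R]_k) : c0 := C0 (linf_seqP x).

(* Coordinates are numbered from 0: the first k ones are the j < k. *)
Definition c0_tail (k : nat) : set c0 := [set z | forall j, (j < k)%N -> z j = 0].

End C0.

(* Main.v *)
From HB Require Import structures.
Require Import Defs.
From mathcomp Require Import all_boot all_order all_algebra.
From mathcomp Require Import all_classical all_reals all_analysis.
From mathcomp Require Import lra.
Set Implicit Arguments.
Unset Strict Implicit.
Unset Printing Implicit Defensive.
Import Order.TTheory GRing.Theory Num.Theory.
Import numFieldNormedType.Exports.
Local Open Scope classical_set_scope.
Local Open Scope ring_scope.

(** A property-(HB) complement G of Y^perp is the kernel of a projection P of
    the dual of c_0 onto Y^perp with |P| <= 1 and |f - P f| < |f| as soon as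
    P f != 0. The dual of c_0 is l_1, and all that is used of l_1 is that cutting
    the coordinates into two complementary sets of indices splits the norm as a
    sum ([norm_dual_restr]).

    The heart of the proof is that Y^perp lives on finitely many coordinates
    ([property_HB_finite_support]). Let h in Y^perp have h(e_n) != 0, and write
    h = h(e_n) eps_n + h', with eps_n the n-th coordinate functional and h'
    vanishing at e_n. Applying P, which fixes h and contracts h', and comparing
    with |h| = |h(e_n)| + |h'| gives |P eps_n| >= 1. Hence
    |eps_n - P eps_n| < 1 <= |P eps_n|; the coordinates other than n contribute
    equally to both sides, so |1 - a| < |a| for a = (P eps_n)(e_n), that is,
    a > 1/2. On the other hand, Y^perp is spanned by finitely many h_i
    ([closed_finite_codim_coordinates]), each with h_i(e_n) -> 0, so the values
    q(e_n) tend to 0 uniformly over the unit ball of Y^perp. Only finitely many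
    indices n can therefore occur.

    Once Y^perp vanishes on the tail Z of c_0, Z is contained in Y, since Y is
    the common kernel of the h_i, and Y = F + Z with F the set of the vectors of
    l_infty(k) lying in Y. Property (HB) then passes between Y and F along the
    inclusion of l_infty(k) in c_0 and the projection onto the first k
    coordinates: a complement on one side is the preimage of a complement on the
    other ([property_HB_row], [property_HB_c0]). For the step from F to Y, the
    part of a functional carried by Z belongs to G and adds the same amount to
    the norms of f and of its G-component, so the strict inequality survives. *)

(** * Functionals on a normed space *)

Section DualSpace.
Context {R : realType} {X : normedModType R}.
Implicit Types (f g : dual_space X) (x y : X).

HB.instance Definition _ f :=
  GRing.isLinear.Build R X R _ (dual_fun f) (dual_linear f).

Lemma dualE f g : (forall x, f x = g x) -> f = g.
Proof. by move=> fg; apply/val_inj/funext => x; exact: fg. Qed.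

Lemma dual_addE f g x : (f + g) x = f x + g x. Proof. by []. Qed.
Lemma dual_oppE f x : (- f) x = - f x. Proof. by []. Qed.
Lemma dual_scaleE a f x : (a *: f) x = a * f x. Proof. by []. Qed.
Lemma dual_applyD f x y : f (x + y) = f x + f y. Proof. exact: linearD. Qed.
Lemma dual_applyB f x y : f (x - y) = f x - f y. Proof. exact: linearB. Qed.
Lemma dual_applyZ f a x : f (a *: x) = a * f x. Proof. exact: linearZ_LR. Qed.
Lemma dual_apply0 f : f 0 = 0. Proof. exact: linear0. Qed.

Lemma dual_norm_apply f x : `|f x| <= `|f| * `|x|.
Proof.
have [->|x0] := eqVneq x 0; first by rewrite dual_apply0 !normr0 mulr0.
have nx : 0 < `|x| by rewrite normr_gt0.
have := @dual_norm_ub _ _ f (`|x|^-1 *: x).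
rewrite normrZ normfV normr_id mulVf ?normr_eq0// => /(_ (lexx _)).
by rewrite dual_applyZ normrM normfV normr_id ler_pdivrMl// mulrC.
Qed.

(** The way all functionals below are produced: the type [dual_space] asks for
    continuity, while the estimates give a bound. *)
Lemma bounded_dual (p : X -> R) (M : R) : linear p ->
  (forall x, `|p x| <= M * `|x|) -> exists f : dual_space X, forall x, f x = p x.
Proof.
move=> lp pM.
suff P : p \in @dual_pred R X by exists (DualSpace P).
rewrite inE /=; split=> //.
pose h : {linear X -> R} :=
  HB.pack p (GRing.isLinear.Build _ _ _ _ _ lp).
have : continuous h; last by [].
apply/linear_bounded_continuous/bounded_funP => r.
exists (`|M| * r) => x xr; apply: le_trans (pM x) _.
by rewrite (le_trans (ler_wpM2r _ (ler_norm M)))// ler_wpM2l.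
Qed.
End DualSpace.

(** * Closed subspaces of finite codimension *)

Section Subspace.
Context {R : realType} {X : normedModType R} (Y : set X).
Hypothesis sY : linear_subspace Y.

Lemma subspaceZD a x y : Y x -> Y y -> Y (a *: x + y).
Proof. by case: sY => _ h Yx Yy; have := h a x y; rewrite !inE; apply. Qed.

Lemma subspace0 : Y 0.
Proof. by case: sY; rewrite inE. Qed.

Lemma subspaceD x y : Y x -> Y y -> Y (x + y).
Proof. by move=> Yx Yy; have := subspaceZD 1 Yx Yy; rewrite scale1r. Qed.

Lemma subspaceZ a x : Y x -> Y (a *: x).
Proof. by move=> Yx; have := subspaceZD a Yx subspace0; rewrite addr0. Qed.

Lemma subspaceB x y : Y x -> Y y -> Y (x - y).
Proof. by move=> Yx Yy; rewrite -scaleN1r addrC; exact: subspaceZD. Qed.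

End Subspace.

Lemma subspaceP {R : realType} {X : normedModType R} (Y : set X) :
  Y 0 -> (forall a x y, Y x -> Y y -> Y (a *: x + y)) -> linear_subspace Y.
Proof. by move=> Y0 YZD; split=> [|a x y]; rewrite !inE //; exact: YZD. Qed.

Lemma closed_normP {R : realType} {X : normedModType R} (Y : set X) :
  closed Y <->
  forall x, (forall e : R, 0 < e -> exists2 y, Y y & `|x - y| < e) -> Y x.
Proof.
split=> [cY x xY|cY x xY].
  apply: cY => U /nbhs_ballP[e /= e0 eU].
  have [y Yy xy] := xY e e0; exists y; split=> //; apply: eU.
  by rewrite -ball_normE.
apply: cY => e e0; have [y [Yy]] := xY _ (nbhsx_ballx x e e0).
by rewrite -ball_normE; exists y.
Qed.

Section AddLine.
Context {R : realType} {X : normedModType R} (Y : set X) (v : X).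
Hypotheses (clY : closed_linear_subspace Y) (Yv : ~ Y v).

Definition add_line : set X := [set x | exists c : R, Y (x - c *: v)].

Let sY : linear_subspace Y. Proof. by case: clY. Qed.

(** Since Y is closed, v has a positive distance d to Y; dividing y + c v by c
    gives a point v - y' with y' in Y. *)
Lemma coefficient_bound :
  exists2 d : R, 0 < d & forall y c, Y y -> `|c| * d <= `|y + c *: v|.
Proof.
have [d d0 dP] : exists2 d : R, 0 < d & forall y, Y y -> d <= `|v - y|.
  apply: contrapT => nd; apply: Yv; case: clY => _ /closed_normP; apply => e e0.
  apply: contrapT => ne; apply: nd; exists e => // y Yy.
  by rewrite leNgt; apply/negP => h; apply: ne; exists y.
exists d => // y c Yy; have [->|c0] := eqVneq c 0.
  by rewrite normr0 mul0r.
have -> : y + c *: v = c *: (v - (- c^-1) *: y).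
  by rewrite scalerBr scaleNr scalerN scalerA mulfV// scale1r opprK addrC.
by rewrite normrZ ler_wpM2l// dP//; exact: subspaceZ.
Qed.

(** Let x be a limit of vectors y + a v with y in Y. By [coefficient_bound] the
    coefficients a of two approximations within e and e' of x differ by at most
    (e + e') / d, so the intervals of radius e / d around them meet pairwise. The
    supremum c of their left ends lies in all of them, and x - c v is then a
    limit of elements of Y. *)
Lemma closed_add_line : closed_linear_subspace add_line.
Proof.
have [d d0 dP] := coefficient_bound.
split.
  apply: subspaceP; first by exists 0; rewrite scale0r subr0; exact: subspace0.
  move=> a x y [c xc] [c' yc]; exists (a * c + c').
  rewrite scalerDl -scalerA opprD addrACA -scalerN -scalerDr.
  exact: subspaceZD.
apply/closed_normP => x xP.
pose A e := [set c : R | exists2 y, Y y & `|x - (y + c *: v)| < e].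
have A0 e : 0 < e -> A e !=set0.
  move=> e0; have [z [c zc] xz] := xP e e0; exists c; exists (z - c *: v) => //.
  by rewrite subrK.
have AA e e' a b : A e a -> A e' b -> a - e / d <= b + e' / d.
  move=> [y Yy xy] [z Yz xz].
  have : `|a - b| * d <= e + e'.
    apply: le_trans (dP (y - z) (a - b) (subspaceB sY Yy Yz)) _.
    have -> : y - z + (a - b) *: v =
        (x - (z + b *: v)) - (x - (y + a *: v)).
      by rewrite scalerBl opprB [RHS]addrC subrKA opprD addrACA.
    by apply: le_trans (ler_normB _ _) _; rewrite addrC lerD// ltW.
  rewrite -ler_pdivlMr// => h; have := le_trans (ler_norm _) h.
  by rewrite mulrDl; lra.
pose L := [set s | exists e a, [/\ 0 < e, A e a & s = a - e / d]].
pose c := sup L.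
have Lub e' b : A e' b -> ubound L (b + e' / d).
  by move=> Ab _ [e [a [_ Aa ->]]]; exact: AA Aa Ab.
have L0 : L !=set0.
  by have [a Aa] := A0 1 ltr01; exists (a - 1 / d), 1, a; split.
have Lc e a : 0 < e -> A e a -> `|c - a| <= e / d.
  move=> e0 Aa.
  have : c <= a + e / d by apply: ge_sup => //; exact: Lub.
  have : a - e / d <= c.
    by apply: ub_le_sup; [exists (a + e / d); exact: Lub|exists e, a].
  by rewrite ler_norml; lra.
exists c; case: clY => _ /closed_normP; apply => e e0.
(* Replacing a by c costs an extra (e / d) |v|; K absorbs it. *)
pose K := 1 + `|v| / d.
have K0 : 0 < K by rewrite ltr_wpDr// divr_ge0// ltW.
have e1 : 0 < e / K by rewrite divr_gt0.
have [a Aa] := A0 _ e1; have ca := Lc _ _ e1 Aa; case: Aa => y Yy xy.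
exists y => //.
have -> : x - c *: v - y = (x - (y + a *: v)) - (c - a) *: v.
  by rewrite scalerBl opprB opprD (addrA x) subrKA addrAC.
apply: le_lt_trans (ler_normB _ _) _; rewrite normrZ.
rewrite (_ : e = e / K + e / K / d * `|v|); last first.
  by rewrite -mulrA [d^-1 * _]mulrC -{1}[e / K]mulr1 -mulrDr divfK// gt_eqF.
by rewrite ltr_leD// ler_wpM2r.
Qed.

End AddLine.

Section FiniteCodim.
Context {R : realType} {X : normedModType R}.
Implicit Types Y : set X.

Lemma annihilator_subspace Y : linear_subspace (annihilator Y).
Proof.
apply: subspaceP => // a f g fY gY y Yy.
by rewrite dual_addE dual_scaleE fY// gY// mulr0 addr0.
Qed.

(** Bounded coordinates modulo Y. They show that Y is the common kernel of the
    h i, and that the h i span the annihilator of Y: every f that vanishes on Y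
    satisfies f = \sum_i f (w i) *: h i. The induction adjoins a spanning vector
    v outside Y to Y; the coordinates modulo Y + R v leave a remainder in
    Y + R v, whose coefficient along v is the missing coordinate, bounded by
    [coefficient_bound]. *)
Lemma closed_finite_codim_coordinates n : forall Y (v : 'I_n -> X),
  closed_linear_subspace Y ->
  (forall x, exists a : 'I_n -> R, Y (x - \sum_(i < n) a i *: v i)) ->
  exists m (h : 'I_m -> dual_space X) (w : 'I_m -> X),
    (forall i, annihilator Y (h i)) /\
    forall x, Y (x - \sum_(i < m) h i x *: w i).
Proof.
elim: n => [|n IHn] Y v clY vY.
  exists 0%N, (fun=> 0), (fun=> 0); split=> // x; rewrite big_ord0.
  by have [a] := vY x; rewrite big_ord0.
have sY := clY.1; have clY' := closed_add_line clY.
have [Yv|Yv] := pselect (Y (v ord0)).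
  apply: (IHn Y (fun i => v (lift ord0 i))) => // x.
  have [a ax] := vY x; exists (fun i => a (lift ord0 i)).
  move: ax; rewrite big_ord_recl opprD addrA addrAC => /subspaceD -/(_ sY).
  by move=> /(_ _ (subspaceZ sY (a ord0) Yv)); rewrite subrK.
have [m [h [w [hY' hw]]]] : exists m (h : 'I_m -> dual_space X)
      (w : 'I_m -> X),
    (forall i, annihilator (add_line Y (v ord0)) (h i)) /\
    forall x, add_line Y (v ord0) (x - \sum_(i < m) h i x *: w i).
  apply: (IHn _ (fun i => v (lift ord0 i))); first exact: clY'.
  move=> x; have [a ax] := vY x; exists (fun i => a (lift ord0 i)), (a ord0).
  by move: ax; rewrite big_ord_recl opprD addrA addrAC.
have hY i : annihilator Y (h i).
  by move=> y Yy; apply: hY'; exists 0; rewrite scale0r subr0.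
pose T x := x - \sum_(i < m) h i x *: w i.
have TZD a x y : T (a *: x + y) = a *: T x + T y.
  rewrite /T scalerBr scaler_sumr addrACA -opprD -big_split/=.
  congr (_ - _); apply: eq_bigr => i _.
  by rewrite dual_applyD dual_applyZ scalerDl scalerA.
have coef_uniq c c' x : Y (x - c *: v ord0) -> Y (x - c' *: v ord0) -> c = c'.
  move=> Yc Yc'; apply/eqP; apply: contrapT => /negP; rewrite -subr_eq0 => cc.
  apply: Yv; rewrite -[v ord0](scalerK cc); apply: subspaceZ => //.
  have := subspaceB sY Yc' Yc.
  by rewrite opprB [X in Y X]addrC subrKA scalerBl.
have [c cP] := choice hw.
have clin : linear c.
  move=> a x y; apply: (coef_uniq _ _ (T (a *: x + y))); first exact: cP.
  rewrite TZD -[a *: c x]/(a * c x) scalerDl -scalerA opprD addrACA.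
  rewrite -scalerN -scalerDr.
  apply: (subspaceZD sY); exact: cP.
have [d d0 dP] := coefficient_bound clY Yv.
have cbound x : `|c x| <= (1 + \sum_(i < m) `|h i| * `|w i|) / d * `|x|.
  rewrite mulrAC ler_pdivlMr//.
  apply: le_trans (dP _ (c x) (cP x)) _; rewrite subrK.
  apply: le_trans (ler_normB _ _) _; rewrite mulrDl mul1r lerD2l mulr_suml.
  apply: le_trans (ler_norm_sum _ _ _) _; apply: ler_sum => i _.
  by rewrite normrZ mulrAC ler_wpM2r// dual_norm_apply.
have [h0 h0E] := bounded_dual clin cbound.
exists m.+1, (fun i => if unlift ord0 i is Some j then h j else h0),
  (fun i => if unlift ord0 i is Some j then w j else v ord0); split.
  move=> i; case: unliftP => [j _|_]; first exact: hY.
  move=> y Yy; rewrite h0E; apply: (coef_uniq _ _ (T y)); first exact: cP.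
  rewrite scale0r subr0 /T big1 ?subr0// => i' _.
  by rewrite (hY i' y Yy) scale0r.
move=> x; rewrite big_ord_recl unlift_none.
under eq_bigr do rewrite liftK.
by rewrite opprD addrA addrAC h0E; exact: cP.
Qed.

End FiniteCodim.

(** * Pulling functionals back along linear contractions *)

Section Pullback.
Context {R : realType} {X X' : normedModType R}.

Definition linear_contraction (T : X -> X') :=
  linear T /\ forall x, `|T x| <= `|x|.

Lemma pullback_subproof T (cT : linear_contraction T) (f : dual_space X') :
  f \o T \in @dual_pred R X.
Proof.
have [lT nT] := cT.
have lin : linear (f \o T).
  by move=> a x y /=; rewrite lT dual_applyD dual_applyZ.
have [//|g gE] := @bounded_dual _ _ _ `|f| lin.
  by move=> x; apply: le_trans (dual_norm_apply f (T x)) _; rewrite ler_wpM2l.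
by rewrite (_ : f \o T = g) ?dual_funP//; apply/funext => x; rewrite gE.
Qed.

Definition pullback T (cT : linear_contraction T) f : dual_space X :=
  DualSpace (pullback_subproof cT f).

Lemma pullbackE T (cT : linear_contraction T) f x : pullback cT f x = f (T x).
Proof. by []. Qed.

Lemma pullback_linear T (cT : linear_contraction T) : linear (pullback cT).
Proof. by move=> a f g; apply: dualE. Qed.

HB.instance Definition _ T (cT : linear_contraction T) :=
  GRing.isLinear.Build R (dual_space X') (dual_space X) _ (pullback cT)
    (pullback_linear cT).

Lemma le_norm_pullback T (cT : linear_contraction T) f : `|pullback cT f| <= `|f|.
Proof.
apply: dual_norm_le => x x1; rewrite pullbackE.
apply: le_trans (dual_norm_apply _ _) _.
by rewrite ler_piMr// (le_trans (cT.2 x)).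
Qed.

Lemma closed_preimage_pullback T (cT : linear_contraction T)
    (G : set (dual_space X)) :
  closed_linear_subspace G -> closed_linear_subspace (pullback cT @^-1` G).
Proof.
move=> [sG cG]; split.
  apply: subspaceP => [|a f g Gf Gg]; rewrite /preimage/=.
    by rewrite linear0; exact: subspace0.
  by rewrite linearP; exact: subspaceZD.
apply/closed_normP => f fP; move/closed_normP: cG; apply => e e0.
have [g Gg fg] := fP e e0; exists (pullback cT g) => //.
by rewrite -linearB; apply: le_lt_trans (le_norm_pullback _ _) fg.
Qed.

End Pullback.

(** * The norm of the dual of c_0 is additive over disjoint supports *)

Section Restriction.
Context {R : realType}.
Implicit Types (u z : c0 R) (A B : pred nat) (f g h : dual_space (c0 R)).

Lemma c0E u z : (forall n, u n = z n) -> u = z.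
Proof. by move=> uz; apply/val_inj/funext => n; exact: uz. Qed.

Lemma c0_cvg u : u n @[n --> \oo] --> (0 : R).
Proof. by have := c0_seqP u; rewrite inE. Qed.

Lemma c0_coord_le u n : `|u n| <= `|u|. Proof. exact: c0_norm_ub. Qed.

Lemma c0_restr_subproof A u :
  (fun n => if A n then u n else 0) \in @c0_pred R.
Proof.
rewrite inE/=; apply/cvgr0Pnorm_lt => e e0.
have /cvgr0Pnorm_lt/(_ e e0) := @c0_cvg u.
by apply: filterS => n; case: ifP => // _; rewrite normr0.
Qed.

Definition c0_restr A u : c0 R := C0 (c0_restr_subproof A u).

Lemma c0_restr_contraction A : linear_contraction (c0_restr A).
Proof.
split=> [a u z|u].
  apply: c0E => n /=.
  rewrite -[RHS]/(a * (if A n then u n else 0) + (if A n then z n else 0)).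
  by case: ifP => // _; rewrite mulr0 addr0.
apply: c0_norm_le => n /=; case: ifP => _; first exact: c0_coord_le.
by rewrite normr0.
Qed.

Definition dual_restr A := pullback (c0_restr_contraction A).

Lemma dual_restrE A f u : dual_restr A f u = f (c0_restr A u).
Proof. by []. Qed.

Lemma c0_restrD A u : c0_restr A u + c0_restr (predC A) u = u.
Proof.
apply: c0E => n.
rewrite -[LHS]/((if A n then u n else 0) + (if ~~ A n then u n else 0)).
by case: (A n); rewrite /= (addr0, add0r).
Qed.

Lemma dual_restrD A f : dual_restr A f + dual_restr (predC A) f = f.
Proof.
apply: dualE => u; rewrite dual_addE.
rewrite !dual_restrE.
rewrite -dual_applyD.
by rewrite c0_restrD.
Qed.

(** The identity |f| = |f|_A| + |f|_(~A)|: if u and z are in the unit ball,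
    then so is every vector that agrees up to sign with u on A and with z outside
    A, so f can nearly attain both norms at once. *)
Lemma norm_dual_restr A f : `|f| = `|dual_restr A f| + `|dual_restr (predC A) f|.
Proof.
apply/eqP; rewrite eq_le -{1}(dual_restrD A f) ler_normD/=.
rewrite -lerBrDr; apply: dual_norm_le => u u1.
rewrite lerBrDr addrC -lerBrDr; apply: dual_norm_le => z z1.
rewrite lerBrDr !dual_restrE.
set a := f (c0_restr A u); set b := f _.
suff H s t : `|s| <= 1 -> `|t| <= 1 -> s * a + t * b <= `|f|.
  have sgle (r : R) : `|Num.sg r| <= 1 by rewrite normr_sg; case: (r != 0).
  by have := H _ _ (sgle a) (sgle b); rewrite -!normrEsg addrC.
move=> s1 t1.
pose p := s *: c0_restr A u + t *: c0_restr (predC A) z.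
have p1 : `|p| <= 1.
  apply: c0_norm_le => n.
  rewrite -[p n]/(s * (if A n then u n else 0) + t * (if ~~ A n then z n else 0)).
  have un := le_trans (c0_coord_le u n) u1.
  have zn := le_trans (c0_coord_le z n) z1.
  by case: (A n); rewrite /= mulr0 (addr0, add0r) normrM mulr_ile1.
have -> : s * a + t * b = f p by rewrite dual_applyD !dual_applyZ.
by apply: le_trans (ler_norm _) _; exact: dual_norm_ub.
Qed.

End Restriction.

(** * The values of a functional at the unit vectors *)

Section Coordinates.
Context {R : realType}.
Implicit Types (u z : c0 R) (f g h : dual_space (c0 R)).

Lemma c0_delta_subproof n : (fun j => (j == n)%:R) \in @c0_pred R.
Proof.
rewrite inE/=; apply: cvg_near_cst; exists n.+1 => // j /= nj.
by rewrite gtn_eqF.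
Qed.

Definition c0_delta n : c0 R := C0 (c0_delta_subproof n).

Lemma norm_c0_delta_le n : `|c0_delta n| <= 1.
Proof.
by apply: c0_norm_le => j /=; case: (j == n); rewrite ?normr1 ?normr0.
Qed.

Lemma c0_restr1 n u : c0_restr (pred1 n) u = u n *: c0_delta n.
Proof.
apply: c0E => j; rewrite -[RHS]/(u n * (j == n)%:R) /=.
by case: eqP => [->|_]; rewrite ?mulr1 ?mulr0.
Qed.

Lemma dual_restr_eqA (A B C : pred nat) f :
  (forall n, C n = A n && B n) ->
  dual_restr A (dual_restr B f) = dual_restr C f.
Proof.
move=> CE; apply: dualE => u; rewrite !dual_restrE; congr (f _).
by apply: c0E => n /=; rewrite CE; case: (A n); case: (B n).
Qed.

Lemma norm_dual_restr1 n f : `|dual_restr (pred1 n) f| = `|f (c0_delta n)|.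
Proof.
apply/eqP; rewrite eq_le; apply/andP; split.
  apply: dual_norm_le => u u1.
  rewrite dual_restrE c0_restr1 dual_applyZ normrM ler_piMl//.
  exact: le_trans (c0_coord_le u n) u1.
have := @dual_norm_ub _ _ (dual_restr (pred1 n) f) _ (norm_c0_delta_le n).
by rewrite dual_restrE c0_restr1 /= eqxx scale1r.
Qed.

Lemma norm_dual_coord n f :
  `|f| = `|f (c0_delta n)| + `|dual_restr (predC (pred1 n)) f|.
Proof. by rewrite (norm_dual_restr (pred1 n) f) norm_dual_restr1. Qed.

(** Splitting off one coordinate at a time. The remainder is kept on the left to
    make the induction go through; dropping it bounds the l_1 norm of the
    sequence f(e_n). *)
Lemma sum_dual_coord N f :
  \sum_(0 <= i < N) `|f (c0_delta i)| + `|dual_restr (leq N) f| = `|f|.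
Proof.
elim: N => [|N <-].
  rewrite big_nil add0r; congr `|_|; apply: dualE => u; rewrite dual_restrE.
  by congr (f _); apply: c0E.
rewrite big_nat_recr//= -addrA; congr (_ + _).
rewrite (norm_dual_coord N (dual_restr (leq N) f)); congr (_ + _).
  congr `|_|; rewrite dual_restrE; congr (f _); apply: c0E => j /=.
  by case: ifPn => //; case: eqP => // ->; rewrite leqnn.
rewrite (@dual_restr_eqA _ _ (leq N.+1))// => n.
by rewrite /= ltn_neqAle eq_sym.
Qed.

Lemma dual_coord_cvg0 f : f (c0_delta n) @[n --> \oo] --> (0 : R).
Proof.
apply: norm_cvg0; apply: (@cvg_series_cvg_0 _ R (fun n => `|f (c0_delta n)|)).
apply: nondecreasing_is_cvgn.
  by apply/nondecreasing_seqP => n; rewrite /series/= big_nat_recr//= lerDl.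
exists `|f| => _ [N _ <-]; rewrite /series/= -(sum_dual_coord N f).
by rewrite lerDl.
Qed.

(** Here it matters that z tends to 0: f takes the same value at z and at the
    tails of z beyond k, and the norms of the tails vanish in the limit. *)
Lemma dual_tail0 k f z : (forall n, (k <= n)%N -> f (c0_delta n) = 0) ->
  c0_tail k z -> f z = 0.
Proof.
move=> fk zk.
have fN N : f z = f (c0_restr (leq (k + N)) z).
  elim: N => [|N ->].
    congr (f _); apply: c0E => j /=; case: leqP => //; rewrite addn0; exact: zk.
  set B := leq _.
  rewrite -{1}(c0_restrD (pred1 (k + N)%N) (c0_restr B z)) dual_applyD.
  rewrite c0_restr1 dual_applyZ fk ?leq_addr// mulr0 add0r; congr (f _).
  apply: c0E => j /=; rewrite /B addnS [RHS]/= (ltn_neqAle _ j) eq_sym.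
  by case: (_ != j).
apply/eqP; rewrite -normr_le0; apply/ler_addgt0Pl => e e0; rewrite addr0.
have f0 : 0 < `|f| + 1 by rewrite ltr_wpDl.
have /cvgr0Pnorm_lt/(_ (e / (`|f| + 1)))[|N _ NP] := @c0_cvg _ z.
  exact: divr_gt0.
rewrite (fN N); apply: le_trans (dual_norm_apply _ _) _.
have zN : `|c0_restr (leq (k + N)) z| <= e / (`|f| + 1).
  apply: c0_norm_le => n /=; case: ifP => [kn|_].
    by apply/ltW/NP => /=; rewrite (leq_trans _ kn)// leq_addl.
  by rewrite normr0 divr_ge0// ltW.
apply: le_trans (ler_wpM2l (normr_ge0 f) zN) _.
by rewrite mulrCA ler_piMr ?(ltW e0)// ler_pdivrMr// mul1r lerDl.
Qed.

End Coordinates.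

(** * Property (HB) forces a finitely supported annihilator *)

Lemma property_HB_finite_support {R : realType} (Y : set (c0 R)) :
  closed_linear_subspace Y -> finite_codim Y -> property_HB Y ->
  exists k, forall h, annihilator Y h ->
    forall n, (k <= n)%N -> h (c0_delta n) = 0.
Proof.
move=> clY [m0 [v0 vY0]] [G [[sG _] [sumG GY] HB]].
have [m [h [v [hY hv]]]] := closed_finite_codim_coordinates clY vY0.
have sA := annihilator_subspace Y.
pose B n := \sum_(i < m) `|h i (c0_delta n)| * `|v i|.
have B0 : B n @[n --> \oo] --> (0 : R).
  rewrite (_ : 0 = \sum_(i < m) `|0 : R| * `|v i|); last first.
    by rewrite big1// => i _; rewrite normr0 mul0r.
  apply: cvg_big => [|i _]; first exact: add_continuous.
  apply: cvgMr_tmp; apply: cvg_norm.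
  exact: dual_coord_cvg0.
(* B n bounds |q (e_n)| for every q of norm at most 1 in the annihilator. *)
have [k _ Bk] : \forall n \near \oo, `|B n| < 2^-1.
  by move/cvgr0Pnorm_lt: B0; apply; rewrite invr_gt0.
exists k => f fY n kn; apply/eqP/negPn/negP => fn0.
have [e eE] : exists e : dual_space (c0 R), forall u, e u = u n.
  by apply: (@bounded_dual _ _ _ 1) => // u; rewrite mul1r c0_coord_le.
have e1 : `|e| <= 1.
  by apply: dual_norm_le => u; rewrite eE; apply/le_trans/c0_coord_le.
have decomp x : exists g q, [/\ G g, annihilator Y q & x = g + q].
  have : [set: dual_space (c0 R)] x by [].
  by rewrite sumG => -[g Gg [q Yq <-]]; exists g, q.
have proj_le x g q : G g -> annihilator Y q -> x = g + q -> `|q| <= `|x|.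
  move=> Gg Yq xE; have [->|q0] := eqVneq q 0; first by rewrite normr0.
  by have [_] := HB x g q xE Gg Yq q0.
(* q is the projection of the coordinate functional e. *)
have [g [q [Gg Yq eq]]] := decomp e.
set f' := dual_restr (predC (pred1 n)) f.
have [g' [q' [Gg' Yq' fq']]] := decomp f'.
pose c := f (c0_delta n).
have fE : f = c *: e + f'.
  apply: dualE => u; rewrite -{1}(dual_restrD (pred1 n) f).
  rewrite !dual_addE dual_scaleE eE; congr (_ + _).
  by rewrite dual_restrE c0_restr1 dual_applyZ mulrC.
(* The projection fixes f: compare the two decompositions of f. *)
have fq : f = c *: q + q'.
  have fqE : f - (c *: q + q') = c *: g + g'.
    apply/eqP; rewrite subr_eq fE {1}eq {1}fq' scalerDr -!addrA.
    by apply/eqP; congr (_ + _); rewrite addrCA; congr (_ + _); rewrite addrCA.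
  apply/eqP; rewrite -subr_eq0; apply/eqP.
  suff : [set 0] (f - (c *: q + q')) by [].
  rewrite -GY; split; last by apply: (subspaceB sA) => //; exact: (subspaceZD sA).
  by rewrite fqE; exact: (subspaceZD sG).
have q1 : 1 <= `|q|.
  have : `|f| <= `|c| * `|q| + `|f'|.
    rewrite {1}fq; apply: le_trans (ler_normD _ _) _.
    by rewrite normrZ lerD2l; exact: proj_le fq'.
  rewrite (norm_dual_coord n f) lerD2r -/c.
  by rewrite ler_pMr// normr_gt0.
have q0 : q != 0 by rewrite -normr_gt0 (lt_le_trans _ q1).
have [ge qe] := HB e g q eq Gg Yq q0.
have gE : g = e - q by rewrite eq addrK.
have gn : g (c0_delta n) = 1 - q (c0_delta n).
  by rewrite gE dual_addE dual_oppE eE /= eqxx.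
have gr : `|dual_restr (predC (pred1 n)) g| = `|dual_restr (predC (pred1 n)) q|.
  rewrite -normrN; congr `|_|; apply: dualE => u.
  by rewrite dual_oppE !dual_restrE gE dual_addE eE /= eqxx add0r opprK.
have qB : `|q (c0_delta n)| <= B n.
  have /eqP := Yq _ (hv (c0_delta n)).
  rewrite dual_applyB subr_eq0 => /eqP ->; rewrite linear_sum.
  apply: le_trans (ler_norm_sum _ _ _) _; apply: ler_sum => i _.
  rewrite /= dual_applyZ normrM ler_wpM2l//.
  apply: le_trans (dual_norm_apply _ _) _; rewrite ler_piMl//.
  exact: le_trans qe e1.
have := le_lt_trans (ler_norm _) (Bk n kn).
have := ler_norm (1 - q (c0_delta n)); have := ler_norm (q (c0_delta n)).
move: q1 (lt_le_trans ge e1).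
rewrite (norm_dual_coord n q) (norm_dual_coord n g) gn gr.
lra.
Qed.

(** * Transfer between c_0 and its first k coordinates *)

Section FirstCoordinates.
Context {R : realType} {k : nat}.
Implicit Types (u z : c0 R) (r : 'rV[R]_k) (f : dual_space (c0 R)).

Lemma c0_addE u z n : (u + z) n = u n + z n. Proof. by []. Qed.

Lemma norm_row_le r (M : R) : 0 <= M -> (forall i, `|r 0 i| <= M) -> `|r| <= M.
Proof.
move=> M0 rM; rewrite [`|r|]mx_normrE; apply/bigmax_leP; split=> // -[i j] _ /=.
by rewrite (ord1 i).
Qed.

Lemma row_coord_le r i : `|r 0 i| <= `|r|.
Proof.
rewrite [`|r|]mx_normrE.
exact: (le_bigmax 0 (fun ij => `|r ij.1 ij.2|) (0, i)).
Qed.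

Definition c0_row u : 'rV[R]_k := \row_i u i.

Lemma linf_c0_contraction : linear_contraction (@linf_c0 R k).
Proof.
split=> [a r s|r].
  apply: c0E => n.
  rewrite -[RHS]/(a * linf_c0 r n + linf_c0 s n) /= /linf_seq.
  by case: insubP => [i _ _|_]; rewrite ?mxE// mulr0 addr0.
apply: c0_norm_le => n; rewrite /= /linf_seq.
by case: insubP => [i _ _|_]; [exact: row_coord_le|rewrite normr0].
Qed.

Lemma linf_c0_0 : linf_c0 (0 : 'rV[R]_k) = 0.
Proof.
by apply: c0E => n; rewrite /= /linf_seq; case: insubP => // i _ _; rewrite mxE.
Qed.

Lemma c0_row_contraction : linear_contraction c0_row.
Proof.
split=> [a u z|u]; first by apply/rowP => i; rewrite !mxE.
by apply: norm_row_le => // i; rewrite mxE c0_coord_le.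
Qed.

Lemma linf_c0K : cancel (@linf_c0 R k) c0_row.
Proof. by move=> r; apply/rowP => i; rewrite mxE /= /linf_seq valK. Qed.

Lemma linf_c0_row u : linf_c0 (c0_row u) = c0_restr (ltn^~ k) u.
Proof.
apply: c0E => n; rewrite /= /linf_seq.
by case: insubP => [i -> <-|/negPf-> //]; rewrite mxE.
Qed.

Lemma c0_restr_tail u : c0_tail k (c0_restr (predC (ltn^~ k)) u).
Proof. by move=> j jk /=; rewrite jk. Qed.

Lemma c0_row_tail z : c0_tail k z -> c0_row z = 0.
Proof. by move=> zk; apply/rowP => i; rewrite !mxE zk. Qed.

Lemma c0_row_tailD u : linf_c0 (c0_row u) + c0_restr (predC (ltn^~ k)) u = u.
Proof. by rewrite linf_c0_row c0_restrD. Qed.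

Definition dual_to_row := pullback linf_c0_contraction.

Definition dual_of_row := pullback c0_row_contraction.

Lemma dual_to_rowE f r : dual_to_row f r = f (linf_c0 r). Proof. by []. Qed.

Lemma dual_of_rowE (g : dual_space 'rV[R]_k) u :
  dual_of_row g u = g (c0_row u).
Proof. by []. Qed.

Lemma dual_of_rowK : cancel dual_of_row dual_to_row.
Proof.
by move=> g; apply: dualE => r; rewrite dual_to_rowE dual_of_rowE linf_c0K.
Qed.

Lemma norm_dual_of_row (g : dual_space 'rV[R]_k) : `|dual_of_row g| = `|g|.
Proof.
apply/eqP; rewrite eq_le le_norm_pullback/=.
by rewrite -{1}(dual_of_rowK g) le_norm_pullback.
Qed.

Lemma dual_to_rowK f : (forall z, c0_tail k z -> f z = 0) ->
  dual_of_row (dual_to_row f) = f.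
Proof.
move=> fk; apply: dualE => u; rewrite -[in RHS](c0_row_tailD u) dual_applyD.
by rewrite (fk _ (c0_restr_tail u)) addr0.
Qed.

Lemma dual_of_row_to_row f :
  dual_of_row (dual_to_row f) = dual_restr (ltn^~ k) f.
Proof.
apply: dualE => u.
by rewrite dual_of_rowE dual_to_rowE dual_restrE linf_c0_row.
Qed.

Lemma norm_dual_to_row f :
  `|f| = `|dual_to_row f| + `|dual_restr (predC (ltn^~ k)) f|.
Proof.
by rewrite (norm_dual_restr (ltn^~ k)) -dual_of_row_to_row norm_dual_of_row.
Qed.

(** A subspace containing the tail is determined by its first k coordinates. *)
Lemma linf_direct_sum_tail (Y : set (c0 R)) : linear_subspace Y ->
  c0_tail k `<=` Y ->
  is_linf_direct_sum Y (@linf_c0 R k @` (@linf_c0 R k @^-1` Y)) (@c0_tail R k).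
Proof.
move=> sY tY.
split; first split.
- apply/seteqP; split=> [y Yy|_ [_ [r Yr <-]] [z zk <-]].
    exists (linf_c0 (c0_row y)).
      exists (c0_row y) => //; rewrite /preimage/= linf_c0_row.
      rewrite -[X in Y X](addrK (c0_restr (predC (ltn^~ k)) y)) c0_restrD.
      by apply: subspaceB => //; apply: tY; exact: c0_restr_tail.
    exists (c0_restr (predC (ltn^~ k)) y); first exact: c0_restr_tail.
    exact: c0_row_tailD.
  by apply: subspaceD => //; exact: tY.
- apply/seteqP; split=> [_ [[r Yr <-] /c0_row_tail]|_ ->].
    by rewrite linf_c0K => ->; exact: linf_c0_0.
  by split=> //; exists 0; rewrite /preimage/= linf_c0_0 //; exact: subspace0.
- move=> _ z [r _ <-] zk.
  have rE n : (k <= n)%N -> linf_c0 r n = 0.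
    by move=> kn; rewrite /= /linf_seq insubF// ltnNge kn.
  apply/eqP; rewrite eq_le; apply/andP; split.
    apply: c0_norm_le => n; rewrite c0_addE.
    case: (ltnP n k) => nk.
      by rewrite (zk _ nk) addr0 le_max c0_coord_le.
    by rewrite (rE _ nk) add0r le_max c0_coord_le orbT.
  rewrite ge_max; apply/andP; split; apply: c0_norm_le => n.
    case: (ltnP n k) => nk; last by rewrite (rE _ nk) normr0.
    rewrite -[linf_c0 r n]addr0 -(zk _ nk).
    by rewrite -c0_addE; exact: c0_coord_le.
  case: (ltnP n k) => nk; first by rewrite (zk _ nk) normr0.
  rewrite -[z n]add0r -(rE _ nk).
  by rewrite -c0_addE; exact: c0_coord_le.
Qed.

(** Functionals on l_infty(k) embed isometrically in the dual of c_0, by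
    [norm_dual_of_row], and the image contains the annihilator of Y; hence the
    decomposition of an embedded functional along G and the annihilator stays
    inside the image, and the norm inequalities are those of c_0. *)
Lemma property_HB_row (Y : set (c0 R)) : linear_subspace Y ->
  c0_tail k `<=` Y -> property_HB Y -> property_HB (@linf_c0 R k @^-1` Y).
Proof.
move=> sY tY [G [cG [sumG GY] HB]].
have annT h : annihilator Y h -> forall z, c0_tail k z -> h z = 0.
  by move=> Yh z zk; apply: Yh; exact: tY.
have annR g : annihilator (@linf_c0 R k @^-1` Y) g <->
    annihilator Y (dual_of_row g).
  split=> gY.
    move=> y Yy; rewrite dual_of_rowE; apply: gY.
    rewrite /preimage/= linf_c0_row.
    rewrite -[X in Y X](addrK (c0_restr (predC (ltn^~ k)) y)) c0_restrD.
    by apply: subspaceB => //; apply: tY; exact: c0_restr_tail.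
  by move=> r Yr; have := gY _ Yr; rewrite dual_of_rowE linf_c0K.
exists (dual_of_row @^-1` G); split; first exact: closed_preimage_pullback.
  split.
    apply/seteqP; split=> // f _.
    have : [set: dual_space (c0 R)] (dual_of_row f) by [].
    rewrite sumG => -[g Gg [h Yh ghf]].
    have hE := dual_to_rowK (annT h Yh).
    have fE : f = dual_to_row g + dual_to_row h.
      by rewrite -[f]dual_of_rowK -ghf; apply: dualE.
    have gE : dual_of_row (dual_to_row g) = g.
      apply: (addIr h); rewrite ghf fE -{1}hE; exact: dualE.
    exists (dual_to_row g); first by rewrite /preimage/= gE.
    by exists (dual_to_row h); [apply/annR; rewrite hE|].
  apply/seteqP; split=> [f [Gf /annR Yf]|_ ->].
    have : [set 0] (dual_of_row f) by rewrite -GY.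
    by move=> /= f0; rewrite -[f]dual_of_rowK f0; apply: dualE.
  split; last exact: subspace0 (annihilator_subspace _).
  exact: subspace0 (closed_preimage_pullback _ cG).1.
move=> f g h fE Gg /annR Yh h0.
rewrite -(norm_dual_of_row f) -(norm_dual_of_row g) -(norm_dual_of_row h).
apply: HB => //; first by rewrite fE; exact: dualE.
by apply: contraNneq h0 => h0; rewrite -normr_eq0 -norm_dual_of_row h0 normr0.
Qed.

(** The complement consists of the f whose restriction to l_infty(k) lies in G,
    with no condition on the tail. Elements of the annihilator of Y vanish on the
    tail, so f and its G-component have the same tail part, which
    [norm_dual_to_row] adds to both sides of the strict inequality given by F. *)
Lemma property_HB_c0 (Y : set (c0 R)) (F : set 'rV[R]_k) :
  linear_subspace F ->
  is_direct_sum Y (@linf_c0 R k @` F) (@c0_tail R k) ->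
  property_HB F -> property_HB Y.
Proof.
move=> sF [YE _] [G [cG [sumG GF] HB]].
have tY : c0_tail k `<=` Y.
  move=> z zk; rewrite YE; exists (linf_c0 (0 : 'rV[R]_k)).
    by exists 0 => //; exact: (subspace0 sF).
  by exists z => //; rewrite linf_c0_0 add0r.
have annT h : annihilator Y h -> forall z, c0_tail k z -> h z = 0.
  by move=> Yh z zk; apply: Yh; exact: tY.
have annR h : annihilator Y h -> annihilator F (dual_to_row h).
  move=> Yh r Fr; rewrite dual_to_rowE; apply: Yh; rewrite YE.
  by exists (linf_c0 r); [exists r|exists 0 => //; rewrite addr0].
have annL g : annihilator F g -> annihilator Y (dual_of_row g).
  move=> Fg y; rewrite YE => -[_ [r Fr <-]] [z zk <-].
  rewrite dual_applyD !dual_of_rowE linf_c0K (c0_row_tail zk).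
  by rewrite Fg// dual_apply0 addr0.
exists (dual_to_row @^-1` G); split; first exact: closed_preimage_pullback.
  split.
    apply/seteqP; split=> // f _.
    have : [set: dual_space 'rV[R]_k] (dual_to_row f) by [].
    rewrite sumG => -[g Gg [h Fh ghf]].
    exists (f - dual_of_row h); last first.
      by exists (dual_of_row h); [exact: annL|rewrite subrK].
    rewrite /preimage/= (_ : dual_to_row _ = g)//.
    rewrite -[g](addrK h) ghf -[in RHS](dual_of_rowK h).
    exact: dualE.
  apply/seteqP; split=> [f [Gf Yf]|_ ->].
    have : [set 0] (dual_to_row f) by rewrite -GF; split=> //; exact: annR.
    move=> /= f0; rewrite -(dual_to_rowK (annT f Yf)) f0.
    exact: dualE.
  split; last exact: subspace0 (annihilator_subspace _).
  exact: subspace0 (closed_preimage_pullback _ cG).1.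
move=> f g h fE Gg Yh h0.
have hE := dual_to_rowK (annT h Yh).
have fE' : dual_to_row f = dual_to_row g + dual_to_row h.
  by rewrite fE; exact: dualE.
have h0' : dual_to_row h != 0.
  by apply: contraNneq h0 => h0; rewrite -hE h0; apply/eqP/dualE.
have [gf hf] := HB _ _ _ fE' Gg (annR _ Yh) h0'.
have fgT : dual_restr (predC (ltn^~ k)) g = dual_restr (predC (ltn^~ k)) f.
  apply: dualE => u; rewrite !dual_restrE fE dual_addE.
  by rewrite (annT h Yh _ (c0_restr_tail u)) addr0.
split; first by rewrite (norm_dual_to_row f) (norm_dual_to_row g) fgT ltrD2r.
rewrite -hE norm_dual_of_row; apply: le_trans hf _.
by rewrite (norm_dual_to_row f) lerDl.
Qed.

End FirstCoordinates.

(** * Subspaces of c_0 with property (HB) *)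

Theorem theorem3p11 (R : realType) (Y : set (c0 R))
    (clY : closed_linear_subspace Y) (fcY : finite_codim Y) :
  property_HB Y <->
  exists (k : nat) (F : set 'rV[R]_k),
    [/\ (0 < k)%N,
        linear_subspace F,
        is_linf_direct_sum Y (@linf_c0 R k @` F) (@c0_tail R k) &
        property_HB F].
Proof.
split=> [HB|[k [F [_ sF [dF _] HB]]]]; last exact: property_HB_c0 dF HB.
have [k kP] := property_HB_finite_support clY fcY HB.
have sY := clY.1.
have tY : c0_tail k.+1 `<=` Y.
  move=> z zk; have [n [v vY]] := fcY.
  (* The functionals h i vanish at z, so z is in their common kernel Y. *)
  have [m [h [w [hY hw]]]] := closed_finite_codim_coordinates clY vY.
  have := hw z; rewrite big1 ?subr0// => i _.
  rewrite (@dual_tail0 _ k.+1)// ?scale0r// => j kj.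
  by apply: kP => //; exact: ltnW.
(* k.+1 rather than k, because the support may be empty. *)
exists k.+1, (@linf_c0 R k.+1 @^-1` Y); split=> //.
- apply: subspaceP => [|a r s Yr Ys]; rewrite /preimage/=.
    by rewrite linf_c0_0; exact: subspace0.
  by rewrite linf_c0_contraction.1; exact: subspaceZD.
- exact: linf_direct_sum_tail.
- exact: property_HB_row.
Qed.
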